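(* Let $\mathbb R^d=\mathbb R^{d_1}\times\cdots\times\mathbb R^{d_n}$, let the uncertainty be supported on the nonempty polyhedral set $\Xi:=\{\xi\in\mathbb R^d:\ C\xi\preceq f\}$, and let $\mathbb A_j:=\{\xi\in\mathbb R^d:\ \langle a_j^l,\xi\rangle<b_j^l\ \text{for all }l\in[\alpha_j]\}$, $j\in[m]$, where $\alpha_j\in\mathbb N_{>0}$, $a_j^l\in\mathbb R^d$, $b_j^l\in\mathbb R$. Let $\mathbb A:=\cup_{j=1}^m\mathbb A_j$, let $Q=\sum_{l=1}^M\vartheta_l\delta_{\xi^l}$ be a discrete distribution with atoms $\xi^1,\ldots,\xi^M\in\Xi$ and masses $\vartheta_1,\ldots,\vartheta_M$, and let $\bm\varepsilon\succeq0$. For any $q=(q_1,\ldots,q_m)\in\prod_{j=1}^m[\alpha_j]$, let $A_q\in\mathbb R^{m\times d}$ be the matrix formed by concatenating the row vectors $(a_j^{q_j})^\top$, $j\in[m]$, and let $b_q:=(b_1^{q_1},\ldots,b_m^{q_m})$. Let $\mathcal J$ be the set of all $q\in\prod_{j=1}^m[\alpha_j]$ for which $\{\xi\in\mathbb R^d:\ A_q\xi\succeq b_q\}$ has nonempty intersection with $\Xi$. Then the optimal value of the program $$\begin{aligned}\inf_{\bm\lambda\succeq0,\,s_l,\,\gamma_{lq},\,\theta_{lq}}\ &\langle\bm\lambda,\bm\varepsilon\rangle+\sum_{l=1}^M\vartheta_l s_l\\ \text{s.t.}\ \ &1-\langle\theta_{lq},b_q-A_q\xi^l\rangle+\langle\gamma_{lq},f-C\xi^l\rangle\le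 s_l,&& l\in[M],\ q\in\mathcal J,\\ &\|\mathrm{pr}_k^{\bm d}(C^\top\gamma_{lq}-A_q^\top\theta_{lq})\|_*\le\lambda_k,&& l\in[M],\ q\in\mathcal J,\ k\in[n],\\ &\gamma_{lq}\succeq0,\ \theta_{lq}\succeq0,\ s_l\ge0,&& l\in[M],\ q\in\mathcal J,\end{aligned}$$ is equal to the probability $$\sup_{P\in\mathcal T_1(Q,\bm\varepsilon)}P(\xi\notin\mathbb A).$$ The variables are $\bm\lambda=(\lambda_1,\ldots,\lambda_n)\in\mathbb R^n$, $s_l\in\mathbb R$, $\theta_{lq}\in\mathbb R^m$, and $\gamma_{lq}$ of the same dimension as $f$; the constraints $s_l\ge0$ hold for all $l\in[M]$.
   Context: Notation: $[N]:=\{1,\ldots,N\}$; $x\succeq y$ (equivalently $y\preceq x$) means all components of $x-y$ are nonnegative; $\bm d:=(d_1,\ldots,d_n)$, $d=d_1+\cdots+d_n$; elements of $\mathbb R^d$ are written $\xi=(\xi_1,\ldots,\xi_n)$ with $\xi_k\in\mathbb R^{d_k}$, and $\mathrm{pr}_k^{\bm d}(\xi)=\xi_k$. Here $C$ is a real matrix with $d$ columns and $f$ a real vector of compatible dimension. Each $\mathbb R^{d_k}$ carries an (arbitrary) norm denoted $\|\cdot\|$ with dual norm $\|z\|_*:=\sup_{\|\xi\|\le1}\langle z,\xi\rangle$. With $\mathcal P(\cdot)$ denoting Borel probability measures, the multi-transport hyperrectangle for $p=1$ is $$\mathcal T_1(Q,\bm\varepsilon):=\Big\{\mathrm{pr}_{2\#}\pi:\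 \pi\in\mathcal P(\Xi\times\Xi),\ \mathrm{pr}_{1\#}\pi=Q,\ \int_{\Xi\times\Xi}\|\zeta_k-\xi_k\|\,d\pi(\zeta,\xi)\le\varepsilon_k\ \text{for all }k\in[n]\Big\},$$ where $\mathrm{pr}_{1\#}\pi,\mathrm{pr}_{2\#}\pi$ are the first and second marginals of $\pi$. *)

(* Defs.v *)
From HB Require Import structures.
From mathcomp Require Import all_boot all_order all_algebra.
From mathcomp Require Import all_classical all_reals all_analysis.

Set Implicit Arguments.
Unset Strict Implicit.
Unset Printing Implicit Defensive.

Import Order.TTheory GRing.Theory Num.Theory.
Import numFieldNormedType.Exports.

Local Open Scope classical_set_scope.
Local Open Scope ring_scope.

(* R^D with its Borel sigma-algebra; matrices carry the product topology.
   The carrier is convertible to 'cV[R]_D. *)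
Notation borel_cV R D := (g_sigma_algebraType (@open 'cV[R]_D)).

Definition inner (R : realType) (D : nat) (x y : 'cV[R]_D) : R :=
  \sum_(i < D) x i 0 * y i 0.

Definition vle (R : realType) (D : nat) (x y : 'cV[R]_D) : Prop :=
  forall i, x i 0 <= y i 0.

(* Nonnegativity and N 0 = 0 follow from the three axioms. *)
Record is_norm (R : realType) (D : nat) (N : 'cV[R]_D -> R) : Prop := {
  is_norm_eq0 : forall x, N x = 0 -> x = 0;
  is_normZ : forall (t : R) x, N (t *: x) = `|t| * N x;
  is_normD : forall x y, N (x + y) <= N x + N y }.

Definition dual_norm (R : realType) (D : nat) (N : 'cV[R]_D -> R)
    (z : 'cV[R]_D) : \bar R :=
  ereal_sup [set (inner z x)%:E | x in [set x | N x <= 1]].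

(* xi = (xi_1, ..., xi_n) is stored as a single column of height
   \sum_k dims k, and xi_k is its k-th block. *)
Definition pr (R : realType) (n : nat) (dims : 'I_n -> nat) (k : 'I_n)
    (xi : 'cV[R]_(\sum_k dims k)) : 'cV[R]_(dims k) :=
  submxcol xi k.

Definition polyhedron (R : realType) (p D : nat) (C : 'M[R]_(p, D))
    (f : 'cV[R]_p) : set 'cV[R]_D :=
  [set xi | vle (C *m xi) f].

Definition open_polyhedron (R : realType) (D r : nat) (a : 'I_r -> 'cV[R]_D)
    (b : 'I_r -> R) : set 'cV[R]_D :=
  [set xi | forall l, inner (a l) xi < b l].

Definition union_open_polyhedra (R : realType) (D m : nat) (alpha : 'I_m -> nat)
    (a : forall j, 'I_(alpha j) -> 'cV[R]_D) (b : forall j, 'I_(alpha j) -> R) :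
    set 'cV[R]_D :=
  \bigcup_j open_polyhedron (a j) (b j).

(* Probabilities on Xi x Xi are rendered as Borel probabilities on R^d x R^d
   giving mass one to Xi x Xi.  The first component of pi has law Q. *)
Definition transport_hyperrectangle (R : realType) (n : nat)
    (dims : 'I_n -> nat) (N : forall k, 'cV[R]_(dims k) -> R)
    (Xi : set 'cV[R]_(\sum_k dims k))
    (Q : probability (borel_cV R (\sum_k dims k)%N) R) (eps : 'cV[R]_n) :
    set (probability (borel_cV R (\sum_k dims k)%N) R) :=
  [set P | exists pi : probability
      (borel_cV R (\sum_k dims k)%N * borel_cV R (\sum_k dims k)%N)%type R,
    [/\ pi (Xi `*` Xi) = 1%E,
        forall B, measurable B -> pushforward pi fst B = Q B,
        forall k, (\int[pi]_(z in Xi `*` Xi)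
          (N k (pr k ((z.1 : 'cV[R]_(\sum_k dims k)) - z.2)))%:E
          <= (eps k 0)%:E)%E
      & forall B, measurable B -> P B = pushforward pi snd B]].

Definition selA (R : realType) (D m : nat) (alpha : 'I_m -> nat)
    (a : forall j, 'I_(alpha j) -> 'cV[R]_D)
    (q : {dffun forall j, 'I_(alpha j)}) : 'M[R]_(m, D) :=
  \matrix_(j, i) a j (q j) i 0.

Definition selb (R : realType) (m : nat) (alpha : 'I_m -> nat)
    (b : forall j, 'I_(alpha j) -> R)
    (q : {dffun forall j, 'I_(alpha j)}) : 'cV[R]_m :=
  \col_j b j (q j).

Definition selJ (R : realType) (D p m : nat) (C : 'M[R]_(p, D)) (f : 'cV[R]_p)
    (alpha : 'I_m -> nat) (a : forall j, 'I_(alpha j) -> 'cV[R]_D)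
    (b : forall j, 'I_(alpha j) -> R) : set {dffun forall j, 'I_(alpha j)} :=
  [set q | [set xi | vle (selb b q) (selA a q *m xi)] `&` polyhedron C f
           !=set0].

(* gamma and theta are indexed by all q, but only those with q in J are
   constrained; the others are irrelevant to the objective. *)
Definition program_feasible (R : realType) (n : nat) (dims : 'I_n -> nat)
    (N : forall k, 'cV[R]_(dims k) -> R)
    (p : nat) (C : 'M[R]_(p, \sum_k dims k)) (f : 'cV[R]_p)
    (m : nat) (alpha : 'I_m -> nat)
    (a : forall j, 'I_(alpha j) -> 'cV[R]_(\sum_k dims k))
    (b : forall j, 'I_(alpha j) -> R)
    (M : nat) (xi : 'I_M -> 'cV[R]_(\sum_k dims k))
    (lambda : 'cV[R]_n) (s : 'I_M -> R)
    (gamma : 'I_M -> {dffun forall j, 'I_(alpha j)} -> 'cV[R]_p)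
    (theta : 'I_M -> {dffun forall j, 'I_(alpha j)} -> 'cV[R]_m) : Prop :=
  [/\ vle 0 lambda,
      forall l, 0 <= s l,
      forall l q, selJ C f a b q ->
        1 - inner (theta l q) (selb b q - selA a q *m xi l)
          + inner (gamma l q) (f - C *m xi l) <= s l,
      forall l q k, selJ C f a b q ->
        (dual_norm (N k) (pr k (C^T *m gamma l q - (selA a q)^T *m theta l q))
          <= (lambda k 0)%:E)%E
    & forall l q, selJ C f a b q -> vle 0 (gamma l q) /\ vle 0 (theta l q)].

Definition program_value (R : realType) (n : nat) (dims : 'I_n -> nat)
    (N : forall k, 'cV[R]_(dims k) -> R) (eps : 'cV[R]_n)
    (p : nat) (C : 'M[R]_(p, \sum_k dims k)) (f : 'cV[R]_p)
    (m : nat) (alpha : 'I_m -> nat)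
    (a : forall j, 'I_(alpha j) -> 'cV[R]_(\sum_k dims k))
    (b : forall j, 'I_(alpha j) -> R)
    (M : nat) (xi : 'I_M -> 'cV[R]_(\sum_k dims k)) (w : 'I_M -> R) : \bar R :=
  ereal_inf [set v | exists lambda s gamma theta,
    program_feasible N C f a b xi lambda s gamma theta /\
    v = (inner lambda eps + \sum_(l < M) w l * s l)%:E].

(* Main.v *)
Require Import Defs.
From mathcomp Require Import all_boot all_order all_algebra.
From mathcomp Require Import all_classical all_reals all_analysis.
From mathcomp Require Import measurable_realfun lra ring.

Import Order.TTheory GRing.Theory Num.Theory.
Import numFieldNormedType.Exports VectorInternalTheory.

Local Open Scope classical_set_scope.
Local Open Scope ring_scope.

(** Weak duality integrates the pointwise bound
    1_(~ A)(z) <= s_l + sum_k lambda_k |xi^l_k - z_k| on Xi against a plan.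

    For strong duality, the transport problem is the finite-dimensional
    program in the masses p_(l,q) moved from xi^l into the polyhedron q and in
    their displacements y_(l,q) = p_(l,q) (z - xi^l):
      maximize sum p_(l,q)  subject to  sum_q p_(l,q) <= w_l,
      sum_(l,q) |(y_(l,q))_k| <= eps_k,
      p (b_q - A_q xi^l) <= A_q y,  C y <= p (f - C xi^l),  0 <= p.
    Its constraints are sublinear, and their only common recession direction
    is 0, so the sum of the squared constraint violations has a minimizer.  If
    the value v is not attained, the violations there are nonzero multipliers,
    which form a dual solution of value less than v: no Slater condition is
    needed, and eps may vanish. *)

Set Implicit Arguments.
Unset Strict Implicit.

(** * Sublinear functions on matrices: bounds and continuity *)

Record sublinear (R : realType) (V : lmodType R) (F : V -> R) : Prop := {
  sublinearD : forall x y, F (x + y) <= F x + F y;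
  sublinearZ : forall t x, 0 <= t -> F (t *: x) = t * F x }.

Section Sublinear.
Context {R : realType}.

Lemma sublinear0 (V : lmodType R) (F : V -> R) : sublinear F -> F 0 = 0.
Proof. by move=> sF; rewrite -(scale0r (0 : V)) sublinearZ // mul0r. Qed.

Lemma sublinear_sum (V : lmodType R) (F : V -> R) (I : finType) (x : I -> V) :
  sublinear F -> F (\sum_i x i) <= \sum_i F (x i).
Proof.
move=> sF; elim/big_rec2 : _ => [|i t v _ le_vt]; first by rewrite sublinear0.
by apply: le_trans (sublinearD sF _ _) _; rewrite lerD2l.
Qed.

Lemma mx_entry_le_norm m n (x : 'M[R]_(m, n)) i j : `|x i j| <= `|x|.
Proof.
rewrite [leRHS]/Num.norm /= mx_normrE.
by apply/bigmax_geP; right; exists (i, j).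
Qed.

(** Expand [x] in the standard basis: each entry contributes at most [|x i j|] times a value of [F]
    at plus or minus a basis matrix. The summand 1 in the constant keeps it positive, so that it can
    be divided by. *)
Lemma sublinear_bound m n (F : 'M[R]_(m, n) -> R) : sublinear F ->
  exists2 B, 0 < B & forall x, F x <= B * `|x|.
Proof.
move=> sF.
pose c ij := `|F (delta_mx ij.1 ij.2)| + `|F (- delta_mx ij.1 ij.2)|.
exists (1 + \sum_ij c ij) => [|x].
  by rewrite ltr_pwDl// sumr_ge0// => ij _; rewrite addr_ge0.
rewrite {1}(matrix_sum_delta x) pair_big.
apply: le_trans (sublinear_sum _ sF) _.
rewrite mulrDl mul1r mulr_suml ler_wpDl// ler_sum// => -[i j] _ /=.
have cij : c (i, j) * `|x i j| <= c (i, j) * `|x|.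
  by rewrite ler_wpM2l ?addr_ge0// mx_entry_le_norm.
apply: le_trans cij; rewrite /c /=; case: (leP 0 (x i j)) => [x0|/ltW x0].
  rewrite sublinearZ// (ger0_norm x0) mulrC ler_wpM2r//.
  by rewrite (le_trans (ler_norm _))// lerDl.
rewrite (ler0_norm x0) -[in leLHS](opprK (x i j)) scaleNr -scalerN.
rewrite sublinearZ ?oppr_ge0// mulrC.
by rewrite ler_wpM2r ?oppr_ge0// (le_trans (ler_norm _))// lerDr.
Qed.

(** Subadditivity bounds [F x - F y] by [F (x - y)] and [F y - F x] by [F (y - x)], so the linear
    bound makes [F] Lipschitz. *)
Lemma sublinear_continuous m n (F : 'M[R]_(m, n) -> R) :
  sublinear F -> continuous F.
Proof.
move=> sF; have [B B0 FB] := sublinear_bound sF.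
move=> x; apply/(@cvgrPdist_le _ _ _ _ (nbhs_filter x)) => e e0.
apply/nbhs_ballP; exists (e / B) => [|y]; first exact: divr_gt0.
rewrite mx_norm_ball => /= xy.
have {}xy : B * `|x - y| <= e by rewrite mulrC -ler_pdivlMr// ltW.
have := sublinearD sF (x - y) y; have := sublinearD sF (y - x) x.
rewrite !subrK; have := FB (x - y); have := FB (y - x).
rewrite distrC => ? ? ? ?; rewrite ler_norml; lra.
Qed.

Definition pospart (r : R) := Num.max r 0.

Lemma pospart_ge0 r : 0 <= pospart r.
Proof. by rewrite le_max lexx orbT. Qed.

(** A one-sided second-order bound for the squared positive part; it replaces a derivative in the
    first-order condition below. The increment [c] may be negative. *)
Lemma sqr_pospart_le h c z :
  z - c <= h -> pospart z ^+ 2 <= (pospart h + c) ^+ 2.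
Proof.
rewrite /pospart; case: (leP z 0) => [_ _|z0 zh].
  by rewrite expr0n sqr_ge0.
have zc : z <= Num.max h 0 + c by case: (leP h 0) => ?; lra.
by rewrite ler_sqr ?nnegrE; lra.
Qed.

Lemma continuous_pospart (T : topologicalType) (f : T -> R) :
  continuous f -> continuous (fun x => pospart (f x)).
Proof.
by move=> cf x; apply: continuous_max; [exact: cf|exact: cst_continuous].
Qed.

(** * A theorem of the alternative for sublinear inequalities *)

Section Alternative.
Context (K : nat) (I : finType) (F : I -> 'rV[R]_K -> R)
  (sF : forall i, sublinear (F i))
  (F_le0 : forall x, (forall i, F i x <= 0) -> x = 0).

(** The sum of positive parts is continuous and positively homogeneous, and it vanishes only at 0 by
    [F_le0]; its minimum on the compact unit sphere is therefore positive and serves as [c]. *)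
Lemma sublinear_coercive :
  exists2 c, 0 < c & forall x, c * `|x| <= \sum_i pospart (F i x).
Proof.
pose S := [set x : 'rV[R]_K | `|x| = 1].
have normalized x : x != 0 -> S (`|x|^-1 *: x).
  move=> x0; rewrite /S/= normrZ ger0_norm ?invr_ge0// mulVf//.
  by rewrite normr_eq0.
have Hcont : continuous (fun x => \sum_i pospart (F i x)).
  apply: continuous_big => [|i _]; first exact: add_continuous.
  apply: continuous_pospart.
  exact: sublinear_continuous.
(* The unit sphere is empty when [K = 0]; then 0 is the only vector and any constant works. *)
have [[s Ss]|S0] := pselect (S !=set0); last first.
  exists 1 => // x; have [->|x0] := eqVneq x 0.
    by rewrite normr0 mulr0 sumr_ge0// => i _; exact: pospart_ge0.
  by exfalso; apply: S0; exists (`|x|^-1 *: x); exact: normalized.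
have cS : compact S.
  apply: bounded_closed_compact.
    exists 1; split => // e e1 x; rewrite /S/= => ->; exact: ltW.
  have -> : S = Num.norm @^-1` [set 1 : R] by [].
  apply: closed_comp => [x _|]; [exact: norm_continuous|exact: closed_eq].
have [c] := EVT_min_rV (ex_intro _ s Ss) cS (continuous_subspaceT Hcont).
rewrite inE => Sc cmin; exists (\sum_i pospart (F i c)).
  rewrite lt_def sumr_ge0 ?andbT => [|i _]; last exact: pospart_ge0.
  apply/eqP => /eqP; rewrite psumr_eq0 => [/allP c0|i _]; last first.
    exact: pospart_ge0.
  have : `|c| = 0; last by rewrite Sc => /eqP; rewrite oner_eq0.
  rewrite [c]F_le0 ?normr0// => i.
  have /eqP <- := c0 i (mem_index_enum _); by rewrite le_max lexx.
move=> x; have [->|x0] := eqVneq x 0.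
  by rewrite normr0 mulr0 sumr_ge0// => i _; exact: pospart_ge0.
rewrite mulrC -ler_pdivlMl ?normr_gt0//.
apply: le_trans (cmin _ (mem_set (normalized x x0))) _.
rewrite mulr_sumr; apply: ler_sum => i _.
by rewrite sublinearZ ?invr_ge0// /pospart maxr_pMr ?invr_ge0// mulr0.
Qed.

Context (u : I -> R).

(** Coercivity makes the sublevel set of [G] at [G 0] bounded, so a minimizer over a ball containing
    it is a global one. *)
Lemma excess_minimizer :
  exists x0, forall x, \sum_i pospart (F i x0 - u i) ^+ 2
                       <= \sum_i pospart (F i x - u i) ^+ 2.
Proof.
have [c c0 cF] := sublinear_coercive.
pose G x := \sum_i pospart (F i x - u i) ^+ 2.
have Gcont : continuous G.
  apply: continuous_big => [|i _]; first exact: add_continuous.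
  have cp : continuous (fun x => pospart (F i x - u i)).
    apply: continuous_pospart => y.
    by apply: continuousB; [exact: sublinear_continuous|exact: cst_continuous].
  by move=> x; apply: (continuousM (cp x) (cp x)).
(* If [G x <= G 0], each excess [r] has [r ^+ 2 <= G 0], hence [r <= G 0 + 1], and the positive part
   of [F i x] exceeds [r] by at most the absolute value of [u i]. *)
pose B := \sum_i (G 0 + 1 + `|u i|).
have GB x : G x <= G 0 -> `|x| <= B / c.
  move=> Gx; rewrite ler_pdivlMr// mulrC; apply: le_trans (cF x) _.
  apply: ler_sum => i _; have : pospart (F i x - u i) ^+ 2 <= G 0.
    apply: le_trans Gx; rewrite /G (bigD1 i)//= lerDl sumr_ge0// => j _.
    exact: sqr_ge0.
  have : pospart (F i x) <= pospart (F i x - u i) + `|u i|.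
    have := ler_norm (u i); have := normr_ge0 (u i).
    rewrite /pospart; case: (leP _ 0) => ?; case: (leP _ 0) => ?; lra.
  move: (pospart _) (pospart _) => r t; nra.
pose A := [set x : 'rV[R]_K | `|x| <= B / c].
have A0 : A 0 by exact: GB.
have cA : compact A.
  apply: bounded_closed_compact.
    exists (B / c); split; first exact: num_real.
    by move=> e /ltW Be x Ax; exact: le_trans Ax Be.
  have -> : A = Num.norm @^-1` [set r : R | r <= B / c] by [].
  apply: closed_comp => [x _|]; [exact: norm_continuous|exact: closed_le].
have [x0 _ x0min] :=
  EVT_min_rV (ex_intro _ _ A0) cA (continuous_subspaceT Gcont).
exists x0 => x; have [Ax|nAx] := pselect (A x); first exact/x0min/mem_set.
apply: le_trans (x0min _ (mem_set A0)) _.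
by case: (leP (G 0) (G x)) => // /ltW /GB.
Qed.

Lemma linear_term_ge0 (S D : R) : 0 <= D ->
  (forall t, 0 < t -> t <= 1 -> 0 <= 2 * S + t * D) -> 0 <= S.
Proof.
move=> D0 SD; rewrite leNgt; apply/negP => S0.
have DS : 0 < D - S by lra.
(* This [t] is small enough that [t * D <= - S], which leaves [2 * S + t * D <= S < 0]. *)
have := SD (- S / (D - S)); rewrite divr_gt0 ?oppr_gt0// ler_pdivrMr// mul1r.
have -> : - S <= D - S by lra.
have : - S / (D - S) * D <= - S.
  by rewrite mulrAC ler_pdivrMr//; nra.
move=> ? /(_ isT isT); lra.
Qed.

(* The multipliers are the constraint violations at the minimizer [x0] of the
   sum of squared violations. *)
Lemma sublinear_alternative_rV :
  (exists x, forall i, F i x <= u i) \/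
  (exists mu : I -> R, [/\ forall i, 0 <= mu i,
     forall x, 0 <= \sum_i mu i * F i x & \sum_i mu i * u i < 0]).
Proof.
have [x0 x0min] := excess_minimizer.
pose mu i := pospart (F i x0 - u i).
have [?|nfeas] := pselect (forall i, F i x0 <= u i); [by left; exists x0|right].
have [i0 mui0] : exists i, 0 < mu i.
  apply: contrapT => /forallNP mu0; apply: nfeas => i.
  by have /negP := mu0 i; rewrite lt_max ltxx orbF subr_gt0 -leNgt.
pose E := \sum_i mu i * F i x0.
(* First-order condition at [x0]. On the segment towards [x], convexity of [F i] and
   [sqr_pospart_le] bound the objective by the sum of [(mu i + t * (F i x - F i x0)) ^+ 2];
   minimality then gives a nonnegative [t * (2 * S + t * D)]. *)
have stationary x : E <= \sum_i mu i * F i x.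
  rewrite -subr_ge0 -sumrB.
  apply: (@linear_term_ge0 _ (\sum_i (F i x - F i x0) ^+ 2)) => [|t t0 t1].
    by apply: sumr_ge0 => i _; exact: sqr_ge0.
  rewrite -(pmulr_rge0 _ t0) -(lerD2l (\sum_i mu i ^+ 2)) addr0.
  apply: le_trans (x0min (x0 + t *: (x - x0))) _.
  rewrite mulrDr !mulr_sumr -!big_split /=; apply: ler_sum => i _.
  have : F i (x0 + t *: (x - x0)) <= F i x0 + t * (F i x - F i x0).
    have -> : x0 + t *: (x - x0) = (1 - t) *: x0 + t *: x.
      by rewrite scalerBr scalerBl scale1r addrCA addrC addrAC -addrA.
    apply: le_trans (sublinearD (sF i) _ _) _.
    by rewrite !(sublinearZ (sF i)) ?subr_ge0 ?(ltW t0)//; lra.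
  move=> ?.
  have := @sqr_pospart_le (F i x0 - u i) (t * (F i x - F i x0))
    (F i (x0 + t *: (x - x0)) - u i).
  rewrite -/(mu i) => H; apply: le_trans (H _) _; first lra.
  by rewrite le_eqVlt; apply/orP; left; apply/eqP; ring.
(* By homogeneity, stationarity tested at 0 gives [E <= 0], and tested at [2 *: x0] it gives
   [E <= 2 * E]. *)
have E0 : E = 0.
  apply/eqP; rewrite eq_le; apply/andP; split.
    rewrite (le_trans (stationary 0))// big1// => i _.
    by rewrite sublinear0// mulr0.
  have : E <= 2 * E; last lra.
  rewrite (le_trans (stationary (2 *: x0)))// mulr_sumr ler_sum// => i _.
  by rewrite sublinearZ// mulrCA.
exists mu; split => [i|x|]; first exact: pospart_ge0.
  by rewrite -[leLHS]E0.
(* Since [mu i] is the positive part of [F i x0 - u i], their product is [mu i ^+ 2]; the violated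
   index [i0] makes the sum strictly negative. *)
have -> : \sum_i mu i * u i = - \sum_i mu i ^+ 2.
  transitivity (\sum_i mu i * u i - E); first by rewrite E0 subr0.
  rewrite -sumrB -sumrN; apply: eq_bigr => i _.
  rewrite /mu /pospart; case: leP => ?; nra.
rewrite oppr_lt0 (bigD1 i0)//= ltr_pwDl ?exprn_gt0// sumr_ge0// => i _.
exact: sqr_ge0.
Qed.

End Alternative.

(** Carries the alternative over to any finite-dimensional space through coordinates, as the
    transport program lives on functions into pairs of a mass and a displacement. *)
Lemma sublinear_alternative (V : vectType R) (I : finType) (F : I -> V -> R)
    (u : I -> R) :
  (forall i, sublinear (F i)) ->
  (forall x, (forall i, F i x <= 0) -> x = 0) ->
  (exists x, forall i, F i x <= u i) \/
  (exists mu : I -> R, [/\ forall i, 0 <= mu i,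
     forall x, 0 <= \sum_i mu i * F i x & \sum_i mu i * u i < 0]).
Proof.
move=> sF F_le0; pose G i (r : 'rV[R]_(dim V)) := F i (r2v r).
have sG i : sublinear (G i).
  by split => [x y|t x t0]; rewrite /G ?linearD ?linearZ; apply sF.
have G_le0 r : (forall i, G i r <= 0) -> r = 0.
  by move=> /F_le0 /(canRL r2vK) ->; rewrite linear0.
have [[r Gr]|[mu [mu0 muG muu]]] := sublinear_alternative_rV sG G_le0 u.
  by left; exists (r2v r).
right; exists mu; split => // x.
by have := muG (v2r x); rewrite /G v2rK.
Qed.

End Sublinear.

(** * Finite mixtures of Dirac masses, and sets of full probability *)

Section FiniteMixture.
Local Open Scope ereal_scope.
Context {R : realType} d {T : measurableType d} (I : finType).

Lemma finite_mixture (c : I -> R) (x : I -> T) :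
  (forall i, (0 <= c i)%R) -> (\sum_i c i = 1)%R ->
  exists P : probability T R,
    (forall A, P A = \sum_i (c i)%:E * \d_(x i) A) /\
    (forall D (f : T -> \bar R), measurable D -> measurable_fun D f ->
      (forall y, D y -> 0 <= f y) ->
      \int[P]_(y in D) f y = \sum_i (c i)%:E * (\d_(x i) D * f (x i))).
Proof.
move=> c0 c1.
have [i0 _|noI] := pickP (mem I); last first.
  by move: c1; rewrite big_pred0// => /eqP; rewrite eq_sym oner_eq0.
pose e n := nth i0 (enum I) n.
pose m n : {measure set T -> \bar R} := mscale (NngNum (c0 (e n))) \d_(x (e n)).
pose k := size (enum I).
have sum_e (F : I -> \bar R) : \sum_(n < k) F (e n) = \sum_i F i.
  transitivity (\sum_(i <- enum I) F i); last by rewrite big_enum.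
  by rewrite (big_nth i0) big_mkord.
pose mu : {measure set T -> \bar R} := msum m k.
have muE A : mu A = \sum_i (c i)%:E * \d_(x i) A.
  by rewrite -(sum_e (fun i => (c i)%:E * \d_(x i) A)).
have muT : mu setT = 1.
  rewrite muE (eq_bigr (fun i => (c i)%:E)); first by rewrite sumEFin c1.
  by move=> i _; rewrite diracT mule1.
(* Normalization turns the measure into a probability; it changes no value, because the total mass
   is already 1. *)
exists (mnormalize mu \d_(x i0)); split => [A|D f mD mf f0].
  by rewrite /= /mnormalize muT/= onee_eq0/= invr1 mule1 muE.
rewrite (@eq_measure_integral _ _ _ _ mu); last first.
  by move=> A _ _; rewrite /= /mnormalize muT/= onee_eq0/= invr1 mule1.
rewrite ge0_integral_measure_sum// -[RHS]sum_e; apply: eq_bigr => n _.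
by rewrite ge0_integral_mscale//= integral_dirac.
Qed.

End FiniteMixture.

Lemma probability_setI_full (R : realType) d (T : measurableType d)
    (P : probability T R) (D E : set T) : measurable D -> measurable E ->
  P D = 1%E -> P (E `&` D) = P E.
Proof.
move=> mD mE PD; transitivity (P (E `\` D) + P (E `&` D))%E; last first.
  exact/esym/measureDI.
suff -> : P (E `\` D) = 0%E by rewrite add0e.
apply/eqP; rewrite eq_le measure_ge0 andbT.
have <- : P (~` D) = 0%E by rewrite probability_setC// PD subee.
by apply: le_measure; rewrite ?inE//; [exact: measurableD|exact: measurableC].
Qed.

(** * Borel measurability on column spaces *)

Section BorelColumns.
Context {R : realType}.

Lemma open_borel_cV D (A : set 'cV[R]_D) :
  open A -> measurable (A : set (borel_cV R D)).
Proof. by move=> oA; apply: sub_sigma_algebra. Qed.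

Lemma closed_borel_cV D (A : set 'cV[R]_D) :
  closed A -> measurable (A : set (borel_cV R D)).
Proof.
move=> cA; rewrite -[A]setCK; apply: measurableC; apply: open_borel_cV.
exact: closed_openC.
Qed.

Lemma measurable_point_cV D (c : borel_cV R D) : measurable [set c].
Proof.
apply: closed_borel_cV.
exact/accessible_closed_set1/hausdorff_accessible/norm_hausdorff.
Qed.

Lemma continuous_borel_cV D (f : 'cV[R]_D -> R) :
  continuous f -> measurable_fun setT (f : borel_cV R D -> R).
Proof.
move=> /continuousP cf.
apply: (measurability (@RGenOpens.G R)).
  exact: RGenOpens.measurableE.
move=> _ [_ [a [b ->] <-]]; rewrite setTI; apply: open_borel_cV.
exact/cf/interval_open.
Qed.

Lemma cV_rat_dense D (x : 'cV[R]_D) (e : R) : 0 < e ->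
  exists r : 'cV[rat]_D, `|x - map_mx ratr r| < e.
Proof.
move=> e0; have /choice[r rP] (i : 'I_D) :
    exists q : rat, ratr q \in `](x i 0 - e), (x i 0 + e)[.
  by apply: rat_in_itvoo; lra.
exists (\col_i r i); rewrite [ltLHS]/Num.norm/= mx_normrE.
apply/bigmax_ltP; split => // -[i j] _; rewrite !mxE (ord1 j).
by have := rP i; rewrite in_itv/= ltr_norml => /andP[]; lra.
Qed.

Lemma sublinear_dist_measurable D (F : 'cV[R]_D -> R) : sublinear F ->
  measurable_fun setT
    (fun z : (borel_cV R D * borel_cV R D)%type => F ((z.1 : 'cV[R]_D) - z.2)).
Proof.
move=> sF; have cF := sublinear_continuous sF.
have [B B0 FB] := sublinear_bound sF.
apply: (measurability (@RGenInftyO.G R)).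
  exact: RGenInftyO.measurableE.
move=> _ [_ [c ->] <-]; rewrite setTI.
pose rv (r : 'cV[rat]_D) : 'cV[R]_D := map_mx ratr r.
pose g r (z : (borel_cV R D * borel_cV R D)%type) :=
  F ((z.1 : 'cV[R]_D) - rv r) + F (rv r - z.2).
rewrite (_ : _ @^-1` _ = \bigcup_r (g r @^-1` `]-oo, c[)); last first.
  apply/seteqP; split => [[x y]|[x y] [r _]]; rewrite /g/= !in_itv/=.
    (* Passing through [r] costs at most [F (x - r) + F (r - x)], hence at most [2 * B] times the
       distance from [x] to [r]; the radius keeps this below [c - F (x - y)]. *)
    move=> xyc; have [|r xr] := @cV_rat_dense D x ((c - F (x - y)) / (2 * B)).
      by rewrite divr_gt0 ?subr_gt0 ?mulr_gt0.
    exists r => //=; rewrite in_itv/=.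
    have := sublinearD sF (rv r - x) (x - y); rewrite addrA subrK.
    have := FB (x - rv r); have := FB (rv r - x); rewrite distrC.
    move: xr; rewrite ltr_pdivlMr ?mulr_gt0// -/(rv r) mulrC; lra.
  have := sublinearD sF (x - rv r) (rv r - y); rewrite addrA subrK; lra.
apply: countable_bigcupT_measurable => [|r]; first exact: countableP.
rewrite -[X in measurable X]setTI.
have mg : measurable_fun setT (g r).
  apply: measurable_funD.
    apply: (measurableT_comp
      (f := fun x : borel_cV R D => F ((x : 'cV[R]_D) - rv r))).
      apply: continuous_borel_cV => x; apply: continuous_comp; last exact: cF.
      by apply: continuousB; [exact: cvg_id|exact: cst_continuous].
    exact: measurable_fst.
  apply: (measurableT_comp
    (f := fun x : borel_cV R D => F (rv r - (x : 'cV[R]_D)))).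
    apply: continuous_borel_cV => x; apply: continuous_comp; last exact: cF.
    by apply: continuousB; [exact: cst_continuous|exact: cvg_id].
  exact: measurable_snd.
exact: mg.
Qed.

End BorelColumns.

(** * Inner products, polyhedra and the block structure *)

Section Inner.
Context {R : realType}.

Lemma inner_mxE D (x y : 'cV[R]_D) : inner x y = (x^T *m y) 0 0.
Proof. by rewrite mxE; apply: eq_bigr => i _; rewrite mxE. Qed.

Lemma innerDr D (x y z : 'cV[R]_D) : inner x (y + z) = inner x y + inner x z.
Proof. by rewrite !inner_mxE mulmxDr mxE. Qed.

Lemma innerBr D (x y z : 'cV[R]_D) : inner x (y - z) = inner x y - inner x z.
Proof. by rewrite !inner_mxE mulmxBr !mxE. Qed.

Lemma innerBl D (x y z : 'cV[R]_D) : inner (x - y) z = inner x z - inner y z.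
Proof. by rewrite !inner_mxE linearB mulmxBl !mxE. Qed.

Lemma innerNr D (x y : 'cV[R]_D) : inner x (- y) = - inner x y.
Proof. by rewrite !inner_mxE mulmxN mxE. Qed.

Lemma innerZr D (t : R) (x y : 'cV[R]_D) : inner x (t *: y) = t * inner x y.
Proof. by rewrite !inner_mxE -scalemxAr mxE. Qed.

Lemma innerZl D (t : R) (x y : 'cV[R]_D) : inner (t *: x) y = t * inner x y.
Proof. by rewrite !inner_mxE linearZ -scalemxAl mxE. Qed.

Lemma inner_sublinear D (x : 'cV[R]_D) : sublinear (inner x).
Proof. by split => [y z|t y _]; rewrite ?innerDr// innerZr. Qed.

Lemma inner_trmx D m (A : 'M[R]_(m, D)) (x : 'cV[R]_m) (y : 'cV[R]_D) :
  inner (A^T *m x) y = inner x (A *m y).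
Proof. by rewrite !inner_mxE trmx_mul trmxK mulmxA. Qed.

Lemma inner_row D m (A : 'M[R]_(m, D)) (y : 'cV[R]_D) i :
  (A *m y) i 0 = inner (row i A)^T y.
Proof. by rewrite inner_mxE trmxK -row_mul [in RHS]mxE. Qed.

Lemma ler_inner D (x y z : 'cV[R]_D) :
  vle 0 x -> vle y z -> inner x y <= inner x z.
Proof.
move=> x0 yz; apply: ler_sum => i _; apply: ler_wpM2l; last exact: yz.
by have := x0 i; rewrite mxE.
Qed.

Lemma open_halfspace D (x : 'cV[R]_D) (c : R) : open [set y | inner x y < c].
Proof.
rewrite (_ : [set y | _] = inner x @^-1` [set r : R | r < c])//.
apply: open_comp => [y _|]; last exact: open_lt.
exact/sublinear_continuous/inner_sublinear.
Qed.

Lemma closed_halfspace D (x : 'cV[R]_D) (c : R) :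
  closed [set y | inner x y <= c].
Proof.
rewrite (_ : [set y | _] = inner x @^-1` [set r : R | r <= c])//.
apply: closed_comp => [y _|]; last exact: closed_le.
exact/sublinear_continuous/inner_sublinear.
Qed.

Lemma closed_polyhedron p D (C : 'M[R]_(p, D)) (f : 'cV[R]_p) :
  closed (polyhedron C f).
Proof.
have -> : polyhedron C f = \bigcap_i [set y | inner (row i C)^T y <= f i 0].
  apply/seteqP; split => [y Cy i _|y Cy i] /=; first by rewrite -inner_row.
  by rewrite inner_row; exact: Cy.
by apply: closed_bigI => i _; exact: closed_halfspace.
Qed.

Lemma measurable_union_open_polyhedra D m (alpha : 'I_m -> nat)
    (a : forall j, 'I_(alpha j) -> 'cV[R]_D) (b : forall j, 'I_(alpha j) -> R) :
  measurable (union_open_polyhedra a b : set (borel_cV R D)).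
Proof.
apply: fin_bigcup_measurable => [|j _]; first exact: finite_finset.
have -> : open_polyhedron (a j) (b j) =
    \bigcap_l [set y | inner (a j l) y < b j l].
  by apply/seteqP; split => [y ay l _|y ay l]; apply: ay.
apply: fin_bigcap_measurable => [|l _]; first exact: finite_finset.
by apply: open_borel_cV; exact: open_halfspace.
Qed.

Lemma inner_pr n (dims : 'I_n -> nat) (x y : 'cV[R]_(\sum_k dims k)) :
  inner x y = \sum_k inner (pr k x) (pr k y).
Proof.
rewrite inner_mxE -[x in LHS]submxcolK -[y in LHS]submxcolK tr_mxcol.
rewrite mul_mxrow_mxcol summxE; apply: eq_bigr => k _.
by rewrite inner_mxE.
Qed.

Lemma prD n (dims : 'I_n -> nat) k (x y : 'cV[R]_(\sum_k dims k)) :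
  pr k (x + y) = pr k x + pr k y.
Proof. by apply/matrixP => i j; rewrite !mxE. Qed.

Lemma prZ n (dims : 'I_n -> nat) k (t : R) (x : 'cV[R]_(\sum_k dims k)) :
  pr k (t *: x) = t *: pr k x.
Proof. by apply/matrixP => i j; rewrite !mxE. Qed.

Lemma pr_inj n (dims : 'I_n -> nat) (x y : 'cV[R]_(\sum_k dims k)) :
  (forall k, pr k x = pr k y) -> x = y.
Proof.
move=> xy; rewrite -[x]submxcolK -[y]submxcolK.
by apply: eq_mxcol => k; exact: xy.
Qed.

(** The embedding of the [k]-th factor, adjoint to [pr k]. The types of blocks [j] and [k] agree
    only along a proof of [j = k], hence [conform_mx]. *)
Definition in_block n (dims : 'I_n -> nat) k (z : 'cV[R]_(dims k)) :
    'cV[R]_(\sum_k dims k) :=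
  \mxcol_j (if j == k then conform_mx 0 z else 0).

Lemma pr_in_block n (dims : 'I_n -> nat) k (z : 'cV[R]_(dims k)) :
  pr k (in_block z) = z.
Proof. by rewrite /pr mxcolK eqxx conform_mx_id. Qed.

Lemma pr_in_block_neq n (dims : 'I_n -> nat) k (z : 'cV[R]_(dims k)) j :
  j != k -> pr j (in_block z) = 0.
Proof. by move=> /negbTE jk; rewrite /pr mxcolK jk. Qed.

Lemma inner_in_block n (dims : 'I_n -> nat) k x (z : 'cV[R]_(dims k)) :
  inner x (in_block z) = inner (pr k x) z.
Proof.
rewrite inner_pr (bigD1 k)//= pr_in_block big1 ?addr0// => j jk.
by rewrite pr_in_block_neq// (sublinear0 (inner_sublinear _)).
Qed.

End Inner.

(** * Abstract norms and their duals *)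

Section Norm.
Context {R : realType} D {N : 'cV[R]_D -> R} (HN : is_norm N).

Lemma norm_fun0 : N 0 = 0.
Proof. by rewrite -(scale0r 0) (is_normZ HN) normr0 mul0r. Qed.

Lemma norm_funN x : N (- x) = N x.
Proof. by rewrite -scaleN1r (is_normZ HN) normrN1 mul1r. Qed.

Lemma norm_fun_ge0 x : 0 <= N x.
Proof.
by have := is_normD HN x (- x); rewrite subrr norm_fun0 norm_funN; lra.
Qed.

Lemma norm_sublinear : sublinear N.
Proof.
by split => [x y|t x t0]; rewrite ?(is_normD HN)// (is_normZ HN) ger0_norm.
Qed.

(** Scaling [x] to norm 1 turns the supremum over the unit ball into a linear inequality for all
    [x]; a vector of norm 0 is 0 and satisfies it trivially. *)
Lemma dual_norm_leP (z : 'cV[R]_D) (c : R) : 0 <= c ->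
  (dual_norm N z <= c%:E)%E <-> forall x, inner z x <= c * N x.
Proof.
move=> c0; split => [zc x|zc].
  have [Nx0|Nx0] := eqVneq (N x) 0.
    rewrite (is_norm_eq0 HN Nx0) norm_fun0 mulr0.
    by rewrite (sublinear0 (inner_sublinear z)).
  have Nx : 0 < N x by rewrite lt_def Nx0 norm_fun_ge0.
  rewrite -ler_pdivrMr// mulrC -innerZr -lee_fin; apply: le_trans zc.
  apply: ereal_sup_ubound; exists ((N x)^-1 *: x) => //=.
  by rewrite (is_normZ HN) ger0_norm ?invr_ge0 ?norm_fun_ge0// mulVf.
apply: ge_ereal_sup => _ [x /= Nx <-]; rewrite lee_fin.
by rewrite (le_trans (zc x))// ler_piMr.
Qed.

End Norm.

Unset Implicit Arguments.

(** * The complement of the union of polyhedra, and the transport cost *)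

Section UncertaintyQuantification.
Context {R : realType} {n : nat} {dims : 'I_n -> nat}
  {N : forall k : 'I_n, 'cV[R]_(dims k) -> R} (HN : forall k, is_norm (N k))
  {p : nat} {C : 'M[R]_(p, \sum_k dims k)} {f : 'cV[R]_p}
  {m : nat} {alpha : 'I_m -> nat}
  {a : forall j : 'I_m, 'I_(alpha j) -> 'cV[R]_(\sum_k dims k)}
  {b : forall j : 'I_m, 'I_(alpha j) -> R}
  {M : nat} {xi : 'I_M -> 'cV[R]_(\sum_k dims k)} {w : 'I_M -> R}
  (Hxi : forall l, polyhedron C f (xi l))
  (Hw0 : forall l, 0 <= w l) (Hw1 : \sum_(l < M) w l = 1)
  {Q : probability (borel_cV R (\sum_k dims k)%N) R}
  (HQ : forall B : set (borel_cV R (\sum_k dims k)%N), measurable B ->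
     Q B = (\sum_(l < M) (w l)%:E
              * \d_(xi l : borel_cV R (\sum_k dims k)%N) B)%E)
  {eps : 'cV[R]_n} (Heps : vle 0 eps).

Local Notation Rd := (borel_cV R (\sum_k dims k)%N).
Local Notation Xi := (polyhedron C f).
Local Notation A := (union_open_polyhedra a b).

Lemma selA_row (q : {dffun forall j, 'I_(alpha j)}) z j :
  (selA a q *m z) j 0 = inner (a j (q j)) z.
Proof. by rewrite mxE; apply: eq_bigr => i _; rewrite mxE. Qed.

(** A point outside every open polyhedron violates some inequality of each; [q] records one such
    choice per [j]. *)
Lemma not_in_union_open_polyhedra z :
  (~ A z) <-> exists q, vle (selb b q) (selA a q *m z).
Proof.
split => [nAz|[q bq] [j _ /(_ (q j))]]; last first.
  by have := bq j; rewrite selA_row mxE leNgt => /negP.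
have viol j : exists l, b j l <= inner (a j l) z.
  apply: contrapT => /forallNP nviol; apply: nAz; exists j => // l.
  by rewrite ltNge; apply/negP; exact: nviol.
exists (@finfun _ (fun j => 'I_(alpha j)) (fun j => xchoose (viol j))) => j.
by rewrite selA_row mxE ffunE; exact: (xchooseP (viol j)).
Qed.

Lemma cost_sublinear k :
  sublinear (fun x : 'cV[R]_(\sum_k dims k) => N k (pr k x)).
Proof.
have sN := norm_sublinear (HN k).
by split => [x y|t x t0]; rewrite ?prD ?prZ ?(sublinearD sN)// (sublinearZ sN).
Qed.

Lemma measurable_cost k : measurable_fun setT
  (fun z : (Rd * Rd)%type =>
     (N k (pr k ((z.1 : 'cV[R]_(\sum_k dims k)) - z.2)))%:E).
Proof.
apply/measurable_EFinP; exact: (sublinear_dist_measurable (cost_sublinear k)).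
Qed.

Lemma measurable_support : measurable (Xi `*` Xi : set (Rd * Rd)).
Proof.
by apply: measurableX; apply: closed_borel_cV; exact: closed_polyhedron.
Qed.

(** * Weak duality *)

Section WeakDuality.
Context {lambda : 'cV[R]_n} {s : 'I_M -> R}
  {gamma : 'I_M -> {dffun forall j, 'I_(alpha j)} -> 'cV[R]_p}
  {theta : 'I_M -> {dffun forall j, 'I_(alpha j)} -> 'cV[R]_m}
  (feas : program_feasible N C f a b xi lambda s gamma theta).

Lemma lambda_ge0 k : 0 <= lambda k 0.
Proof. by case: feas => + _ _ _ _ => /(_ k); rewrite mxE. Qed.

(** If [z] lies outside [A], the [q] it violates belongs to [selJ], with [z] as witness. Add to the
    first dual constraint the signs of [theta] against [A_q z - b_q] and of [gamma] against
    [f - C z]; what remains is a pairing with [xi l - z], bounded blockwise by the dual norms. *)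
Lemma feasible_indicator_le l z : Xi z ->
  \1_(~` A) z <= s l + \sum_k lambda k 0 * N k (pr k (xi l - z)).
Proof.
case: feas => lam0 s0 dual1 dual2 sgn Xz.
have cost0 : 0 <= \sum_k lambda k 0 * N k (pr k (xi l - z)).
  by apply: sumr_ge0 => k _; rewrite mulr_ge0 ?lambda_ge0// norm_fun_ge0.
rewrite indicE; case: (boolP (z \in ~` A)) => [|_]; last by rewrite addr_ge0.
rewrite inE => /not_in_union_open_polyhedra[q bq].
have Jq : selJ C f a b q by exists z.
have [gam0 the0] := sgn l q Jq.
have := ler_inner the0 bq; have := ler_inner gam0 Xz.
have := dual1 l q Jq; rewrite !innerBr.
have : inner (C^T *m gamma l q - (selA a q)^T *m theta l q) (xi l - z) <=
    \sum_k lambda k 0 * N k (pr k (xi l - z)).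
  rewrite inner_pr; apply: ler_sum => k _.
  exact: (dual_norm_leP (HN k) _ (lambda_ge0 k)).1 (dual2 l q k Jq) _.
rewrite innerBl !inner_trmx !mulmxBr !innerBr /=; lra.
Qed.

(* Atoms may coincide, so the slack of an atom is the least [s l] over the
   indices [l] representing it. *)
Lemma atom_slack : exists sigma : 'cV[R]_(\sum_k dims k) -> R,
  [/\ forall x, 0 <= sigma x, forall l, sigma (xi l) <= s l &
    forall l z, Xi z -> \1_(~` A) z
      <= sigma (xi l) + \sum_k lambda k 0 * N k (pr k (xi l - z))].
Proof.
have s0 l : 0 <= s l by case: feas.
suff /choice[sigma Hsigma] : forall x, exists v, [/\ 0 <= v,
    forall l, xi l = x -> v <= s l &
    forall l z, xi l = x -> Xi z -> \1_(~` A) z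
      <= v + \sum_k lambda k 0 * N k (pr k (xi l - z))].
  exists sigma; split => [x|l|l z].
  - by have [] := Hsigma x.
  - by have [_ H _] := Hsigma (xi l); exact: H.
  - by have [_ _ H] := Hsigma (xi l); exact: H.
(* At a point that is no atom both conditions on the slack are vacuous, and 0 serves. *)
move=> x; have [[l0 xl0]|nx] := pselect (exists l, xi l = x); last first.
  by exists 0; split => // l *; exfalso; apply: nx; exists l.
case: (@arg_minP _ _ _ l0 (fun l => xi l == x) s); first exact/eqP.
move=> l /eqP xl lmin; exists (s l); split => // [l' /eqP|l' z xl' Xz].
  exact: lmin.
by rewrite xl' -xl; exact: feasible_indicator_le.
Qed.

Lemma weak_duality (P : probability Rd R) :
  transport_hyperrectangle N Xi Q eps P ->
  (P (~` A) <= (inner lambda eps + \sum_l w l * s l)%:E)%E.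
Proof.
move=> [pi [piXi pi1 picost pi2]].
have [sigma [sigma0 sigma_s Hsigma]] := atom_slack.
pose D : set (Rd * Rd) := Xi `*` Xi.
have mD : measurable D := measurable_support.
pose S : set Rd := range (xi : 'I_M -> Rd).
have mS : measurable S.
  rewrite /S -bigcup_imset1; apply: fin_bigcup_measurable => [|l _].
    exact: finite_finset.
  exact: measurable_point_cV.
pose pts : seq Rd := undup (codom (xi : 'I_M -> Rd)).
have sigma_pts l :
    \sum_(c <- pts) sigma c * \1_[set c] (xi l : Rd) = sigma (xi l).
  rewrite (bigD1_seq (xi l : Rd)) ?undup_uniq ?mem_undup ?codom_f//=.
  rewrite indicE mem_set// mulr1 big1 ?addr0// => c cl.
  by rewrite indicE memNset ?mulr0// => /= /esym /eqP; rewrite (negbTE cl).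
have fst_le (E : set Rd) : measurable E ->
    (\int[pi]_(z in D) (\1_E z.1)%:E <= Q E)%E.
  move=> mE; have mfE : measurable (fst @^-1` E : set (Rd * Rd)).
    by rewrite -[X in measurable X]setTI; exact: measurable_fst.
  rewrite -pi1// (integral_indic pi mD mfE); exact: measureIl.
have mA : measurable (~` A : set Rd).
  by apply: measurableC; exact: measurable_union_open_polyhedra.
have mfA : measurable (snd @^-1` (~` A) : set (Rd * Rd)).
  by rewrite -[X in measurable X]setTI; exact: measurable_snd.
have -> : P (~` A) = (\int[pi]_(z in D) (\1_(~` A) z.2)%:E)%E.
  rewrite pi2// (integral_indic pi mD mfA); exact/esym/probability_setI_full.
have mfst (E : set Rd) : measurable E ->
    measurable_fun D (fun z : Rd * Rd => (\1_E z.1)%:E : \bar R).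
  move=> mE; apply/measurable_EFinP; apply: measurable_funTS.
  apply: measurableT_comp; last exact: measurable_fst.
  exact: measurable_indic.
(* The majorant [h] has three parts: [h0] covers sources that are no atoms, where it is already 1;
   [h1 c] is the slack of the atom [c], as a simple function of the source; [h2 k] is the priced
   cost of block [k]. *)
pose h0 (z : Rd * Rd) : \bar R := (\1_(~` S) z.1)%:E.
pose h1 c (z : Rd * Rd) : \bar R := ((sigma c)%:E * (\1_[set c] z.1)%:E)%E.
pose cost k (z : Rd * Rd) : \bar R :=
  (N k (pr k ((z.1 : 'cV[R]_(\sum_k dims k)) - z.2)))%:E.
pose h2 k (z : Rd * Rd) : \bar R := ((lambda k 0)%:E * cost k z)%E.
have cost_ge0 k z : (0 <= cost k z)%E by rewrite lee_fin norm_fun_ge0.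
have h1_ge0 c z : (0 <= h1 c z)%E by rewrite mule_ge0 ?lee_fin.
have h2_ge0 k z : (0 <= h2 k z)%E by rewrite mule_ge0// lee_fin lambda_ge0.
have mh0 : measurable_fun D h0 by apply: mfst; exact: measurableC.
have mh1 c : measurable_fun D (h1 c).
  by apply: measurable_funeM; apply: mfst; exact: measurable_point_cV.
have mcost k : measurable_fun D (cost k).
  by apply: measurable_funTS; exact: measurable_cost.
have mh2 k : measurable_fun D (h2 k) by exact: measurable_funeM.
pose h z : \bar R := (h0 z + \sum_(c <- pts) h1 c z + \sum_k h2 k z)%E.
have mh01 : measurable_fun D (fun z => h0 z + \sum_(c <- pts) h1 c z)%E.
  by apply: emeasurable_funD => //; exact: emeasurable_sum.
apply: (@le_trans _ _ (\int[pi]_(z in D) h z)%E).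
  apply: ge0_le_integral => //.
  - apply/measurable_EFinP; apply: measurable_funTS.
    apply: measurableT_comp; last exact: measurable_snd.
    exact: measurable_indic.
  - by apply: emeasurable_funD => //; exact: emeasurable_sum.
  move=> [x z] [/= Xx Xz]; rewrite /h.
  have -> : (\sum_(c <- pts) h1 c (x, z))%R =
      (\sum_(c <- pts) sigma c * \1_[set c] x)%:E by rewrite -sumEFin.
  have -> : (\sum_k h2 k (x, z))%R =
      (\sum_k lambda k 0 * N k (pr k (x - z)))%:E by rewrite -sumEFin.
  rewrite /h0 /= -!EFinD lee_fin.
  have [[l _ <-]|nSx] := pselect (S x).
    have -> : \1_(~` S) (xi l : Rd) = 0 :> R.
      by rewrite indicE memNset//; apply; exists l.
    by rewrite sigma_pts add0r; exact: Hsigma.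
  have -> : \1_(~` S) x = 1 :> R by rewrite indicE mem_set.
  have : \1_(~` A) z <= 1 :> R by rewrite indicE; case: (_ \in _).
  move=> /le_trans; apply; rewrite -addrA lerDl addr_ge0// sumr_ge0// => i _.
    by rewrite mulr_ge0.
  by rewrite mulr_ge0 ?lambda_ge0// norm_fun_ge0.
have h01_ge0 z : D z -> (0 <= h0 z + \sum_(c <- pts) h1 c z)%E.
  by move=> _; rewrite adde_ge0 ?lee_fin// sume_ge0.
have sh1_ge0 z : D z -> (0 <= \sum_(c <- pts) h1 c z)%E.
  by move=> _; rewrite sume_ge0.
have sh2_ge0 z : D z -> (0 <= \sum_k h2 k z)%E.
  by move=> _; rewrite sume_ge0.
have msh1 : measurable_fun D (fun z => \sum_(c <- pts) h1 c z)%E.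
  exact: emeasurable_sum.
have msh2 : measurable_fun D (fun z => \sum_k h2 k z)%E.
  exact: emeasurable_sum.
have h0_ge0 z : D z -> (0 <= h0 z)%E by move=> _; rewrite lee_fin.
rewrite (ge0_integralD pi mD h01_ge0 mh01 sh2_ge0 msh2).
rewrite (ge0_integralD pi mD h0_ge0 mh0 sh1_ge0 msh1).
rewrite !ge0_integral_sum//.
(* The first marginal is [Q], which gives no mass to the complement of its atoms. *)
have -> : (\int[pi]_(z in D) h0 z = 0)%E.
  apply/eqP; rewrite eq_le integral_ge0// andbT.
  apply: le_trans (fst_le _ _) _; first exact: measurableC.
  rewrite HQ; last exact: measurableC.
  rewrite big1// => l _; rewrite diracE memNset ?mule0//.
  by apply; exists l.
rewrite add0e addeC EFinD; apply: leeD.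
  rewrite -sumEFin; apply: lee_sum => k _; rewrite ge0_integralZl//.
    by rewrite EFinM lee_wpmul2l ?lee_fin ?lambda_ge0//; exact: picost.
  by rewrite lee_fin lambda_ge0.
apply: (@le_trans _ _ (\sum_(c <- pts) (sigma c)%:E * Q [set c])%E).
  apply: lee_sum => c _; rewrite ge0_integralZl//.
  - by rewrite lee_wpmul2l ?lee_fin// fst_le//; exact: measurable_point_cV.
  - by apply: mfst; exact: measurable_point_cV.
  - by rewrite lee_fin.
have QE c : Q [set c] = (\sum_l w l * \1_[set c] (xi l : Rd))%:E.
  by rewrite -sumEFin HQ; last exact: measurable_point_cV.
(* Exchanging the sums regroups distinct atoms by index: index [l] sees only the slack of its own
   atom, which is at most [s l]. *)
rewrite [leLHS](eq_bigr
  (fun c : Rd => (\sum_l sigma c * (w l * \1_[set c] (xi l : Rd)))%:E)).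
  rewrite sumEFin lee_fin exchange_big/=; apply: ler_sum => l _.
  rewrite (eq_bigr (fun c : Rd => w l * (sigma c * \1_[set c] (xi l : Rd)))).
    by rewrite -mulr_sumr sigma_pts ler_wpM2l.
  by move=> c _; rewrite mulrCA.
by move=> c _; rewrite QE -EFinM mulr_sumr.
Qed.

End WeakDuality.

(** * Transport plans from masses and displacements *)

Section MassTransport.
Local Notation Qt := {dffun forall j, 'I_(alpha j)}.

(* [mass l q] is the mass moved out of the atom [xi l] and [flux l q] its total
   displacement, so that it lands at [xi l + (mass l q)^-1 *: flux l q]; when
   [mass l q = 0], this is [xi l] since [0^-1 = 0]. *)
Lemma transport_plan (mass : 'I_M -> Qt -> R)
    (flux : 'I_M -> Qt -> 'cV[R]_(\sum_k dims k)) :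
  (forall l q, 0 <= mass l q) ->
  (forall l, \sum_q mass l q <= w l) ->
  (forall k, \sum_l \sum_q N k (pr k (flux l q)) <= eps k 0) ->
  (forall l q, vle (mass l q *: (selb b q - selA a q *m xi l))
                   (selA a q *m flux l q)) ->
  (forall l q, vle (C *m flux l q) (mass l q *: (f - C *m xi l))) ->
  exists2 P, transport_hyperrectangle N Xi Q eps P &
    ((\sum_l \sum_q mass l q)%:E <= P (~` A))%E.
Proof.
move=> mass0 massw cost fluxA fluxC.
(* [inl l] indexes the mass that stays at [xi l], and [inr (l, q)] the mass moved into the
   polyhedron of [q]. *)
pose I : finType := ('I_M + 'I_M * Qt)%type.
pose land l q := xi l + (mass l q)^-1 *: flux l q.
pose c (i : I) : R := match i with
  | inl l => w l - \sum_q mass l q | inr (l, q) => mass l q end.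
pose src (i : I) : Rd := match i with inl l => xi l | inr (l, q) => xi l end.
pose dst (i : I) : Rd := match i with
  | inl l => xi l | inr (l, q) => land l q end.
have sumI (F : I -> \bar R) :
    (\sum_i F i = \sum_l F (inl l) + \sum_l \sum_q F (inr (l, q)))%E.
  by rewrite big_sumType/= pair_big; congr (_ + _)%E; apply: eq_bigr => -[].
have c0 i : 0 <= c i by case: i => [l|[l q]]; rewrite /c ?subr_ge0.
have c1 : \sum_i c i = 1.
  rewrite big_sumType/= -Hw1 sumrB.
  have -> : \sum_(i : 'I_M * Qt) c (inr i) = \sum_l \sum_q mass l q.
    by rewrite pair_big; apply: eq_bigr => -[].
  by rewrite subrK.
have land_Xi l q : Xi (land l q).
  rewrite /land; have := fluxC l q; have := mass0 l q; rewrite le_eqVlt.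
  move=> /predU1P[<- _|mlq]; first by rewrite invr0 scale0r addr0.
  move=> H i; have := H i; rewrite mulmxDr -scalemxAr.
  move: (C *m _) (C *m _) => cy cx; rewrite !mxE.
  by rewrite -ler_pdivrMl// lerBrDl.
have land_A l q : 0 < mass l q -> ~ A (land l q).
  move=> mlq; apply/not_in_union_open_polyhedra; exists q => j.
  have := fluxA l q j; rewrite /land mulmxDr -scalemxAr.
  move: (selb b q) (selA a q *m _) (selA a q *m _) => bq cy cx; rewrite !mxE.
  by rewrite -ler_pdivlMl// lerBlDl.
have dst_Xi i : Xi (dst i) by case: i => [l|[l q]]; rewrite /dst.
have src_Xi i : Xi (src i) by case: i => [l|[l q]]; rewrite /src.
have [pi [piE piint]] := finite_mixture (fun i => (src i, dst i)) c0 c1.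
have [P [PE _]] := finite_mixture dst c0 c1.
have Ppi B : P B = pushforward pi snd B by rewrite /pushforward piE PE.
exists P; first exists pi; first split.
- rewrite piE (eq_bigr (fun i => (c i)%:E)); first by rewrite sumEFin c1.
  move=> i _; rewrite diracE mem_set ?mule1//.
  by split; [exact: src_Xi|exact: dst_Xi].
- move=> B mB; rewrite HQ// /pushforward piE sumI.
  rewrite -big_split/=; apply: eq_bigr => l _.
  set B' := \d_(xi l : Rd) B.
  transitivity ((c (inl l))%:E * B' + \sum_q (mass l q)%:E * B')%E; first by [].
  rewrite -ge0_sume_distrl => [|q _]; last by rewrite lee_fin.
  rewrite sumEFin -ge0_muleDl ?lee_fin ?c0//; last exact: sumr_ge0.
  by rewrite -EFinD /= subrK.
- move=> k; rewrite piint//; last first.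
  + by move=> z _; rewrite lee_fin norm_fun_ge0.
  + by apply: measurable_funTS; exact: measurable_cost.
  + exact: measurable_support.
  rewrite sumI big1 => [|l _].
    rewrite add0e; apply: (@le_trans _ _
      (\sum_l \sum_q N k (pr k (flux l q)))%:E).
      rewrite -sumEFin; apply: lee_sum => l _.
      rewrite -sumEFin; apply: lee_sum => q _.
      rewrite diracE mem_set; last first.
        by split; [exact: (src_Xi (inr (l, q)))|exact: land_Xi].
      rewrite mul1e -EFinM lee_fin /= /land opprD addrA subrr add0r -scaleNr.
      rewrite prZ (is_normZ (HN k)) normrN.
      rewrite ger0_norm ?invr_ge0// mulrA.
      rewrite ler_piMl ?norm_fun_ge0//.
      (* The factor [m * m^-1] is 1 for a positive mass and 0 for a zero mass, so the cost never
         exceeds that of the displacement. *)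
      have [->|m0] := eqVneq (mass l q) 0; first by rewrite mul0r.
      by rewrite mulfV.
    by rewrite lee_fin.
  by rewrite /= subrr (sublinear0 (cost_sublinear k)) !mule0.
- by [].
rewrite PE sumI -sumEFin.
apply: (@le_trans _ _ (\sum_l \sum_q
    (c (inr (l, q)))%:E * \d_(dst (inr (l, q))) (~` A : set Rd))%E).
  apply: lee_sum => l _; rewrite -sumEFin; apply: lee_sum => q _.
  (* A zero mass may land inside [A] but contributes nothing; a positive one lands outside. *)
  have := mass0 l q; rewrite le_eqVlt => /predU1P[<-|mlq].
    by rewrite mule_ge0 ?lee_fin// dirac_ge0.
  by rewrite diracE mem_set ?mule1//; exact: land_A.
rewrite leeDr// sume_ge0// => l _.
by rewrite mule_ge0 ?lee_fin ?c0.
Qed.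

End MassTransport.

(** * Strong duality through multipliers *)

Section Multipliers.
Local Notation Qt := {dffun forall j, 'I_(alpha j)}.
Local Notation T := ('I_M * Qt)%type.
Local Notation V := {ffun T -> R^o * 'cV[R]_(\sum_k dims k)}.

Local Notation gap t := (selb b t.2 - selA a t.2 *m xi t.1).
Local Notation slack t := (f - C *m xi t.1).

(* In order: the objective, the budgets [eps], the masses [w], the inequalities
   of [A_q], those of [C], and the signs of the masses. *)
Definition constraint : finType :=
  (unit + 'I_n + 'I_M + T * 'I_m + T * 'I_p + T)%type.

Definition constraint_fun (i : constraint) (x : V) : R :=
  match i with
  | inl (inl (inl (inl (inl _)))) => - \sum_t (x t).1
  | inl (inl (inl (inl (inr k)))) => \sum_t N k (pr k (x t).2)
  | inl (inl (inl (inr l))) => \sum_q (x (l, q)).1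
  | inl (inl (inr (t, j))) =>
      (x t).1 * gap t j 0 - (selA a t.2 *m (x t).2) j 0
  | inl (inr (t, i)) => (C *m (x t).2) i 0 - (x t).1 * slack t i 0
  | inr t => - (x t).1
  end.

Definition constraint_rhs (v : R) (i : constraint) : R :=
  match i with
  | inl (inl (inl (inl (inl _)))) => - v
  | inl (inl (inl (inl (inr k)))) => eps k 0
  | inl (inl (inl (inr l))) => w l
  | _ => 0
  end.

Lemma constraint_sublinear i : sublinear (constraint_fun i).
Proof.
have fstD (x y : V) t : ((x + y) t).1 = (x t).1 + (y t).1 by rewrite ffunE.
have sndD (x y : V) t : ((x + y) t).2 = (x t).2 + (y t).2 by rewrite ffunE.
have fstZ c (x : V) t : ((c *: x) t).1 = c * (x t).1 by rewrite ffunE.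
have sndZ c (x : V) t : ((c *: x) t).2 = c *: (x t).2 by rewrite ffunE.
have mD d (y z : 'cV[R]_d) i' : (y + z) i' 0 = y i' 0 + z i' 0 by rewrite mxE.
have mZ d c (y : 'cV[R]_d) i' : (c *: y) i' 0 = c * y i' 0 by rewrite mxE.
case: i => [[[[[u|k]|l]|[t j]]|[t i]]|t]; split => [x y|c x c0] /=.
- by rewrite -opprD -big_split; under eq_bigr do rewrite fstD.
- by rewrite mulrN mulr_sumr; under eq_bigr do rewrite fstZ.
- rewrite -big_split; apply: ler_sum => t _; rewrite sndD.
  exact: (sublinearD (cost_sublinear k)).
- rewrite mulr_sumr; apply: eq_bigr => t _; rewrite sndZ.
  exact: (sublinearZ (cost_sublinear k)).
- by rewrite -big_split; under eq_bigr do rewrite fstD.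
- by rewrite mulr_sumr; under eq_bigr do rewrite fstZ.
- by rewrite fstD sndD mulmxDr !mD; lra.
- by rewrite fstZ sndZ -scalemxAr mZ; ring.
- by rewrite fstD sndD mulmxDr !mD; lra.
- by rewrite fstZ sndZ -scalemxAr mZ; ring.
- by rewrite fstD; lra.
- by rewrite fstZ; lra.
Qed.

(** The recession cone is trivial: nonnegative masses with nonpositive row sums vanish, and then the
    budget rows force every block of every displacement to have norm 0. *)
Lemma constraint_le0 x : (forall i, constraint_fun i x <= 0) -> x = 0.
Proof.
move=> x0; apply/ffunP => t; rewrite ffunE.
have fst_ge0 t' : 0 <= (x t').1 by have := x0 (inr t'); rewrite /= oppr_le0.
have fst0 : (x t).1 = 0.
  have := x0 (inl (inl (inl (inr t.1)))) => /=; rewrite (bigD1 t.2)//=.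
  have : 0 <= \sum_(q | q != t.2) (x (t.1, q)).1 by apply: sumr_ge0.
  have := fst_ge0 t; case: t => l q /=; lra.
have snd0 : (x t).2 = 0.
  apply: pr_inj => k; have N0 := norm_fun_ge0 (HN k).
  rewrite [RHS](_ : _ = 0); last by apply/matrixP => i j; rewrite !mxE.
  apply: (is_norm_eq0 (HN k)); have := x0 (inl (inl (inl (inl (inr k))))) => /=.
  rewrite (bigD1 t)//=; have := N0 (pr k (x t).2).
  have : 0 <= \sum_(t' | t' != t) N k (pr k (x t').2) by apply: sumr_ge0.
  lra.
by rewrite [LHS]surjective_pairing fst0 snd0.
Qed.

(** The contribution of a single pair [t] to the weighted sum of constraints: that sum separates
    over pairs, so its nonnegativity can be tested one pair at a time. *)
Definition lagrangian (mu : constraint -> R) (t : T) (r : R)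
    (y : 'cV[R]_(\sum_k dims k)) : R :=
  let theta := \col_j mu (inl (inl (inr (t, j)))) in
  let gamma := \col_i mu (inl (inr (t, i))) in
  - mu (inl (inl (inl (inl (inl tt))))) * r
  + \sum_k mu (inl (inl (inl (inl (inr k))))) * N k (pr k y)
  + mu (inl (inl (inl (inr t.1)))) * r
  + (r * inner theta (gap t) - inner theta (selA a t.2 *m y))
  + (inner gamma (C *m y) - r * inner gamma (slack t))
  - mu (inr t) * r.

Lemma sum_lagrangian mu x :
  \sum_i mu i * constraint_fun i x = \sum_t lagrangian mu t (x t).1 (x t).2.
Proof.
rewrite !big_sumType /= /lagrangian !big_split /=.
congr (_ + _ + _ + _ + _ + _).
- rewrite (big_pred1 tt) => [|[]//].
  by rewrite mulrN -mulNr mulr_sumr.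
- by rewrite exchange_big; apply: eq_bigr => k _; rewrite mulr_sumr.
- under eq_bigr do rewrite mulr_sumr.
  by rewrite pair_big; apply: eq_bigr => -[].
- rewrite -big_split [RHS](eq_bigr (fun t => \sum_j mu (inl (inl (inr (t, j))))
      * ((x t).1 * gap t j 0 - (selA a t.2 *m (x t).2) j 0))).
    by rewrite pair_big; apply: eq_bigr => -[].
  move=> t _; rewrite /= /inner mulr_sumr -sumrB; apply: eq_bigr => j _.
  by rewrite [(\col_j' _) j 0]mxE; ring.
- rewrite -big_split [RHS](eq_bigr (fun t => \sum_i mu (inl (inr (t, i)))
      * ((C *m (x t).2) i 0 - (x t).1 * slack t i 0))).
    by rewrite pair_big; apply: eq_bigr => -[].
  move=> t _; rewrite /= /inner mulr_sumr -sumrB; apply: eq_bigr => i _.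
  by rewrite [(\col_i' _) i 0]mxE; ring.
- by apply: eq_bigr => t _; rewrite mulrN.
Qed.

Lemma lagrangian0 mu t : lagrangian mu t 0 0 = 0.
Proof.
rewrite /lagrangian !mulmx0 !mul0r !mulr0 !(sublinear0 (inner_sublinear _)).
rewrite big1 => [|k _]; first by rewrite !subr0 !addr0.
by rewrite (sublinear0 (cost_sublinear k)) mulr0.
Qed.

(** Testing with a unit mass that does not move yields the first dual constraint. *)
Lemma lagrangian10 mu t :
  lagrangian mu t 1 0 =
  - mu (inl (inl (inl (inl (inl tt))))) + mu (inl (inl (inl (inr t.1))))
  + inner (\col_j mu (inl (inl (inr (t, j))))) (gap t)
  - inner (\col_i mu (inl (inr (t, i)))) (slack t) - mu (inr t).
Proof.
rewrite /lagrangian !mulmx0 !mul1r !mulr1 !(sublinear0 (inner_sublinear _)).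
rewrite (_ : \sum_k _ = 0); first by ring.
by apply: big1 => k _; rewrite (sublinear0 (cost_sublinear k)) mulr0.
Qed.

(** Testing with no mass and a displacement in block [k] alone yields the dual norm constraint for
    [k]. *)
Lemma lagrangian_in_block mu t k (z : 'cV[R]_(dims k)) :
  lagrangian mu t 0 (- in_block z) =
  mu (inl (inl (inl (inl (inr k))))) * N k z
  + inner (\col_j mu (inl (inl (inr (t, j))))) (selA a t.2 *m in_block z)
  - inner (\col_i mu (inl (inr (t, i)))) (C *m in_block z).
Proof.
rewrite /lagrangian !mulmxN !innerNr.
rewrite (_ : \sum_k _ = mu (inl (inl (inl (inl (inr k))))) * N k z).
  by ring.
rewrite (bigD1 k)//= -scaleN1r prZ pr_in_block (is_normZ (HN k)) normrN1 mul1r.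
rewrite [X in _ + X]big1 ?addr0// => j jk.
by rewrite prZ pr_in_block_neq// scaler0 norm_fun0// mulr0.
Qed.

Lemma lagrangian_ge0 mu :
  (forall x, 0 <= \sum_i mu i * constraint_fun i x) ->
  forall t r y, 0 <= lagrangian mu t r y.
Proof.
move=> mu_ge0 t r y.
pose x : V := [ffun t' => if t' == t then (r, y) else 0].
have xt : x t = (r, y) by rewrite ffunE eqxx.
have xt' t' : t' != t -> x t' = 0 by move=> /negbTE t't; rewrite ffunE t't.
have := mu_ge0 x; rewrite sum_lagrangian (bigD1 t)//= xt.
rewrite [X in _ + X]big1 ?addr0// => t' /xt' ->; exact: lagrangian0.
Qed.

Lemma strong_duality (v : R) :
  (forall P, transport_hyperrectangle N Xi Q eps P ->
     (P (~` A) < v%:E)%E) ->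
  exists lambda s gamma theta,
    program_feasible N C f a b xi lambda s gamma theta /\
    inner lambda eps + \sum_l w l * s l < v.
Proof.
(* A solution of the system would give a plan placing mass at least [v] outside [A], against [Pv];
   so multipliers exist. *)
move=> Pv; have [[x xfeas]|[mu [mu0 muF muu]]] :=
  sublinear_alternative (constraint_rhs v) constraint_sublinear constraint_le0.
  have [|||||P TP] := @transport_plan
    (fun l q => (x (l, q)).1) (fun l q => (x (l, q)).2).
  - by move=> l q; have := xfeas (inr (l, q)); rewrite /= oppr_le0.
  - by move=> l; exact: xfeas (inl (inl (inl (inr l)))).
  - move=> k.
    rewrite pair_big (eq_bigr (fun t => N k (pr k (x t).2))) => [|[]//].
    exact: xfeas (inl (inl (inl (inl (inr k))))).
  - move=> l q j; have /= := xfeas (inl (inl (inr ((l, q), j)))).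
    by rewrite subr_le0 => H; rewrite mxE.
  - move=> l q i; have /= := xfeas (inl (inr ((l, q), i))).
    by rewrite subr_le0 => H; rewrite [leRHS]mxE.
  rewrite pair_big (eq_bigr (fun t => (x t).1)) => [|[]//].
  have := xfeas (inl (inl (inl (inl (inl tt))))).
  rewrite /= lerN2 => vx Px; have := le_lt_trans Px (Pv P TP).
  by rewrite lte_fin ltNge vx.
have L0 := lagrangian_ge0 mu muF.
pose tau := mu (inl (inl (inl (inl (inl tt))))).
pose lam k := mu (inl (inl (inl (inl (inr k))))).
pose sig l := mu (inl (inl (inl (inr l)))).
pose theta t := \col_j mu (inl (inl (inr (t, j)))).
pose gamma t := \col_i mu (inl (inr (t, i))).
have muu' : - (tau * v) + \sum_k lam k * eps k 0 + \sum_l sig l * w l < 0.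
  have -> : - (tau * v) + \sum_k lam k * eps k 0 + \sum_l sig l * w l =
      \sum_i mu i * constraint_rhs v i; last exact: muu.
    rewrite !big_sumType /= (big_pred1 tt) => [|[]//].
    rewrite mulrN [X in _ = _ + X]big1 => [|t _]; last by rewrite mulr0.
    rewrite addr0 [X in _ = _ + X]big1 => [|[t i] _]; last by rewrite mulr0.
    rewrite addr0 [X in _ = _ + X]big1 => [|[t j] _]; last by rewrite mulr0.
    by rewrite addr0.
(* With [tau = 0] the left side of [muu'] would be a sum of products of nonnegative numbers. Hence
   one may divide by the multiplier of the objective. *)
have tau0 : 0 < tau.
  rewrite lt_def mu0 andbT; apply: contraTneq muu' => ->.
  rewrite mul0r oppr0 add0r -leNgt addr_ge0// sumr_ge0// => [k|l] _.
    by rewrite mulr_ge0//; [exact: mu0|have := Heps k; rewrite mxE].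
  by rewrite mulr_ge0//; exact: mu0.
exists (tau^-1 *: \col_k lam k), (fun l => tau^-1 * sig l),
  (fun l q => tau^-1 *: gamma (l, q)), (fun l q => tau^-1 *: theta (l, q)).
split; first split.
- by move=> k; rewrite !mxE; apply: mulr_ge0; [rewrite invr_ge0 ltW|exact: mu0].
- by move=> l; apply: mulr_ge0; [rewrite invr_ge0 ltW|exact: mu0].
(* The constant 1 is written as [tau^-1 * tau]; the multiplier of the sign constraint is nonnegative
   and is dropped. *)
- move=> l q _; have := L0 (l, q) 1 0; rewrite lagrangian10.
  rewrite -/tau -/(theta (l, q)) -/(gamma (l, q)) -/(sig l) !innerZl => L.
  rewrite -[X in X - _](mulVf (lt0r_neq0 tau0)) -mulrBr -mulrDr.
  by rewrite ler_pM2l ?invr_gt0//; have := mu0 (inr (l, q)); move: L => /=; lra.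
- move=> l q k _; rewrite !mxE.
  apply/(dual_norm_leP (HN k)) => [|z].
    by rewrite mulr_ge0 ?invr_ge0 ?(ltW tau0)//; exact: mu0.
  rewrite -inner_in_block -!scalemxAr -scalerBr innerZl -mulrA.
  rewrite ler_pM2l ?invr_gt0// innerBl !inner_trmx.
  have := L0 (l, q) 0 (- in_block z); rewrite lagrangian_in_block.
  rewrite -/(theta (l, q)) -/(gamma (l, q)) -/(lam k) /=; lra.
- move=> l q _; split => j; rewrite !mxE.
    by apply: mulr_ge0; [rewrite invr_ge0 ltW|exact: mu0].
  by apply: mulr_ge0; [rewrite invr_ge0 ltW|exact: mu0].
have -> : inner (tau^-1 *: \col_k lam k) eps = tau^-1 * \sum_k lam k * eps k 0.
  by rewrite innerZl; congr (_ * _); apply: eq_bigr => k _; rewrite mxE.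
have -> : \sum_l w l * (tau^-1 * sig l) = tau^-1 * \sum_l sig l * w l.
  by rewrite mulr_sumr; apply: eq_bigr => l _; ring.
by rewrite -mulrDr ltr_pdivrMl//; lra.
Qed.

End Multipliers.

(** Leaving all mass in place costs nothing, which is within the nonnegative budgets. *)
Lemma transport_hyperrectangle_nonempty :
  transport_hyperrectangle N Xi Q eps !=set0.
Proof.
have [|||||P TP _] := @transport_plan (fun _ _ => 0) (fun _ _ => 0).
6: by exists P.
- by [].
- by move=> l; rewrite big1.
- move=> k; rewrite big1 => [|l _]; first by have := Heps k; rewrite mxE.
  by rewrite big1// => q _; rewrite (sublinear0 (cost_sublinear k)).
- by move=> l q j; rewrite scale0r mulmx0.
- by move=> l q j; rewrite scale0r mulmx0.
Qed.

End UncertaintyQuantification.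

(** * Equality of the program value and the worst-case probability *)

Theorem corollary6p2 (R : realType)
  (n : nat) (dims : 'I_n -> nat)
  (N : forall k : 'I_n, 'cV[R]_(dims k) -> R)
  (HN : forall k : 'I_n, is_norm (N k))
  (p : nat) (C : 'M[R]_(p, \sum_k dims k)) (f : 'cV[R]_p)
  (HXi : polyhedron C f !=set0)
  (m : nat) (alpha : 'I_m -> nat) (Halpha : forall j : 'I_m, (0 < alpha j)%N)
  (a : forall j : 'I_m, 'I_(alpha j) -> 'cV[R]_(\sum_k dims k))
  (b : forall j : 'I_m, 'I_(alpha j) -> R)
  (M : nat) (xi : 'I_M -> 'cV[R]_(\sum_k dims k)) (w : 'I_M -> R)
  (Hxi : forall l : 'I_M, polyhedron C f (xi l))
  (Hw0 : forall l : 'I_M, 0 <= w l) (Hw1 : \sum_(l < M) w l = 1)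
  (Q : probability (borel_cV R (\sum_k dims k)%N) R)
  (HQ : forall B : set (borel_cV R (\sum_k dims k)%N), measurable B ->
     Q B = (\sum_(l < M) (w l)%:E * \d_(xi l : borel_cV R (\sum_k dims k)%N) B)%E)
  (eps : 'cV[R]_n) (Heps : vle 0 eps) :
  program_value N eps C f a b xi w =
  ereal_sup [set P (~` union_open_polyhedra a b)
            | P in transport_hyperrectangle N (polyhedron C f) Q eps].
Proof.
apply/eqP; rewrite eq_le; apply/andP; split; last first.
  apply: ge_ereal_sup => _ [P TP <-]; apply: le_ereal_inf_tmp.
  move=> _ [lambda [s [gamma [theta [feas ->]]]]].
  exact: (weak_duality HN Hw0 HQ feas P TP).
set V := ereal_sup _.
have V_ub P : transport_hyperrectangle N (polyhedron C f) Q eps P ->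
    (P (~` union_open_polyhedra a b) <= V)%E.
  by move=> TP; apply: ereal_sup_ubound; exists P.
have Vfin : V \is a fin_num.
  have [P TP] := transport_hyperrectangle_nonempty HN Hxi Hw0 Hw1 HQ Heps
    (b := b) (a := a).
  rewrite fin_real//; apply/andP; split.
    apply: lt_le_trans (V_ub P TP).
    by rewrite (lt_le_trans _ (measure_ge0 _ _)).
  apply: (@le_lt_trans _ _ 1%E); last exact: ltry.
  apply: ge_ereal_sup => _ [P' _ <-]; apply: probability_le1.
  by apply: measurableC; exact: measurable_union_open_polyhedra.
(* The supremum is not known to be attained, and [strong_duality] requires a strict bound on all
   probabilities; it is applied at [V + e], where finiteness of [V] makes the inequality strict. *)
apply/lee_addgt0Pr => e e0.
have [P /V_ub PV|lambda [s [gamma [theta [feas val]]]]] :=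
  strong_duality HN Hxi Hw0 Hw1 HQ Heps (fine V + e) (a := a) (b := b).
  apply: le_lt_trans PV _.
  by rewrite -[ltLHS](fineK Vfin) lte_fin ltrDl.
rewrite -(fineK Vfin) -EFinD; apply: (@le_trans _ _
  (inner lambda eps + \sum_l w l * s l)%:E); last by rewrite lee_fin ltW.
by apply: ereal_inf_lbound; exists lambda, s, gamma, theta.
Qed.
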